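(* Let $\mathbb{K}$ be a domain as described in the context that is in addition distributive and $\sigma$-compact. Let $\varphi$ be a completely monotone Scott function on $\mathbb{K}$, and let $\mu$ be the representation of $\varphi$ over $\mathcal{F}$, i.e. the unique Radon measure on $\mathcal{F}$ with $\varphi(x)=\mu(\{V\in\mathcal{F}: x\in V\})$ for all $x\in\mathbb{K}$. Then $\varphi$ is a locally finite valuation if and only if $\mu(\mathcal{P}_{\mathrm{lf}})=1$.
   Context: A dcpo is a poset in which every (nonempty) directed subset has a supremum. In a dcpo, $x\ll y$ means that every directed $E$ with $y\le\sup E$ contains some $w$ with $x\le w$. A domain is a dcpo in which, for each $x$, the set $\{z: z\ll x\}$ is a directed lower set with supremum $x$. A subset $U$ is Scott open if it is an upper set and meets every directed $E$ with $\sup E\in U$. The Lawson topology has as subbase the Scott open sets together with the complements of the principal upper sets $\{z: x\le z\}$. $\mathbb{K}$ is a domain which is also a lattice with top element $\hat1$, such that $\hat1\ll\hat1$ and $\ll$ is multiplicative: $a\ll x$, $b\ll y$ imply $a\wedge b\ll x\wedge y$. $\mathbb{K}$ is $\sigma$-compact if there is a countable subset $\{w_i\}$ with $\mathbb{K}=\bigcup_i\{z: w_i\le z\}$; a sequence $\{w_i\}$ with this property and $w_{i+1}\ll w_i$ for all $i\ge 1$ is fixed. $\mathcal{F}=\mathrm{OFilt}(\mathbb{K})$ is the set of Scott open filters (nonempty, down-directed Scott open sets) of $\mathbb{K}$ ordered by inclusion; it is a continuous lattice whose Lawson topology is compact Hausdorff. A Radon measure is a Borel measure, finite on compact sets, inner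 regular on open sets and outer regular on Borel sets. A Scott function is a function $\varphi:\mathbb{K}\to[0,\infty)$ with $\varphi(x)=\sup_{z\ll x}\varphi(z)$ for all $x$ (in particular increasing), normalized by $\varphi(\hat1)=1$. Put $\nabla_z\varphi(x)=\varphi(x)-\varphi(x\wedge z)$, $\nabla_{z_1,\ldots,z_n}\varphi=\nabla_{z_n}(\nabla_{z_1,\ldots,z_{n-1}}\varphi)$, which depends only on $A=\{z_1,\ldots,z_n\}$ and is denoted $\nabla_A\varphi$; put $\nabla_\varnothing\varphi=\varphi$. An increasing $\varphi$ is completely monotone if $\nabla_A\varphi\ge0$ for every nonempty finite $A$. (For completely monotone Scott functions $\mu$ exists and is unique.) $P$ is the set of prime elements of $\mathbb{K}$: those $z\ne\hat1$ such that $z=x\wedge y$ implies $z=x$ or $z=y$. For $A\subseteq\mathbb{K}$, $\langle A\rangle=\{z: z\le a\text{ for some }a\in A\}$. $\mathcal{P}_k=\{\mathbb{K}\setminus\langle A\rangle: A\subseteq P,\ 0\le|A|\le k\}\subseteq\mathcal{F}$. Let $\Xi_i(V)=V\cap\{z: w_i\ll z\}$ for $V\in\mathcal{F}$. Then $$\mathcal{P}_{\mathrm{lf}}=\bigcap_{i=1}^\infty\bigcup_{k=1}^\infty\Xi_i^{-1}(\Xi_i(\mathcal{P}_k)),$$ which is an $F_{\sigma\delta}$ subset of $\mathcal{F}$. For a finite sublattice $F$ of $\mathbb{K}$ with bottom $\hat0_F=\bigwedge F$ and $x\in F$, let $B_F^x$ be the set of maximal elements of $\{y\in F: x\not\le y\}$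 (so $B_F^{\hat0_F}=\varnothing$). A completely monotone Scott function $\varphi$ is a locally finite valuation if for every $w\in\mathbb{K}$ and $\delta>0$ there is a positive integer $k$ such that $$\sum_{x\in F,\ 0\le|B_F^x|\le k}\nabla_{B_F^x}\varphi(x)\ge 1-\delta$$ for every finite sublattice $F$ of $\mathbb{K}$ with $w\le\hat0_F$.
   Formalization: In the definition of a locally finite valuation, the finite sublattices F are required to contain the top element of K; with F={w} allowed the condition would force φ=1, and the claim fails for K={0<1}, φ(0)=1/2. *)

(* Defs.v *)
From HB Require Import structures.
From mathcomp Require Import all_boot all_order all_algebra finmap.
From mathcomp Require Import all_classical all_reals all_analysis.

Set Implicit Arguments.
Unset Strict Implicit.
Unset Printing Implicit Defensive.

Import Order.TTheory GRing.Theory Num.Theory.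

(* [classical_set_scope] is opened last, so that `&`, `|`, ~` are the set
   operations; the lattice ones carry an explicit %O. *)
Local Open Scope ring_scope.
Local Open Scope order_scope.
Local Open Scope classical_set_scope.

Definition directed d (T : porderType d) (E : set T) : Prop :=
  E !=set0 /\
  forall x y, E x -> E y -> exists z, [/\ E z, x <= z & y <= z].

Definition down_directed d (T : porderType d) (E : set T) : Prop :=
  E !=set0 /\
  forall x y, E x -> E y -> exists z, [/\ E z, z <= x & z <= y].

Definition upper_set d (T : porderType d) (U : set T) : Prop :=
  forall x y, U x -> x <= y -> U y.

Definition lower_set d (T : porderType d) (U : set T) : Prop :=
  forall x y, U y -> x <= y -> U x.

Definition principal_upper d (T : porderType d) (x : T) : set T :=
  [set z | x <= z].

Definition is_dcpo d (T : porderType d) : Prop :=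
  forall E : set T, directed E -> exists s, isLub E s.

Definition way_below d (T : porderType d) (x y : T) : Prop :=
  forall (E : set T) (s : T), directed E -> isLub E s -> y <= s ->
  exists2 w, E w & x <= w.

Definition is_domain d (T : porderType d) : Prop :=
  is_dcpo T /\
  forall x : T, let B := [set z | way_below z x] in
    [/\ directed B, lower_set B & isLub B x].

Definition scott_open d (T : porderType d) (U : set T) : Prop :=
  upper_set U /\
  forall (E : set T) (s : T), directed E -> isLub E s -> U s ->
  exists2 z, E z & U z.

Definition lawson_subbase d (T : porderType d) : set (set T) :=
  [set U | scott_open U] `|` [set ~` principal_upper x | x in [set: T]].

Definition way_below_multiplicative d (K : tLatticeType d) : Prop :=
  forall a b x y : K, way_below a x -> way_below b y ->
  way_below (a `&` b)%O (x `&` y)%O.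

Definition sigma_compact d (T : porderType d) : Prop :=
  exists2 W : set T, countable W & \bigcup_(x in W) principal_upper x = setT.

Definition scott_open_filter d (T : porderType d) (V : set T) : Prop :=
  scott_open V /\ down_directed V.

(* The poset OFilt(K), with the inclusion order inherited from [set K] and
   the Lawson topology of that order. *)
Record OFilt d (K : tLatticeType d) := MkOFilt {
  ofilt_set :> set K;
  ofilt_setP : `[< scott_open_filter ofilt_set >] }.

HB.instance Definition _ d (K : tLatticeType d) :=
  [isSub for @ofilt_set d K].
HB.instance Definition _ d (K : tLatticeType d) := [Choice of OFilt K by <:].
HB.instance Definition _ d (K : tLatticeType d) :=
  [SubChoice_isSubPOrder of OFilt K by <: with set_display].

Lemma le_ofiltE d (K : tLatticeType d) (V W : OFilt K) :
  (V <= W) = `[< ofilt_set V `<=` ofilt_set W >].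
Proof. by []. Qed.

Lemma scott_open_filterT d (K : tLatticeType d) :
  scott_open_filter [set: K].
Proof.
split; split=> //.
- by move=> E s [[z Ez] _] _ _; exists z.
- by exists \top.
- by move=> x y _ _; exists (x `&` y)%O; split=> //; [exact: leIl|exact: leIr].
Qed.

(* Base point K itself; measurable types are pointed in the library. *)
HB.instance Definition _ d (K : tLatticeType d) :=
  isPointed.Build (OFilt K) (MkOFilt (asboolT (@scott_open_filterT d K))).

HB.instance Definition _ d (K : tLatticeType d) :=
  isSubBaseTopological.Build (OFilt K) (@lawson_subbase _ (OFilt K)) id.

Notation borelOFilt K := (g_sigma_algebraType (@open (OFilt K))).

Definition radon_measure (R : realType) d (K : tLatticeType d)
    (mu : {measure set (borelOFilt K) -> \bar R}) : Prop :=
  [/\ forall C : set (OFilt K), compact C -> (mu C < +oo)%E,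
      forall U : set (OFilt K), open U ->
        mu U = ereal_sup
          [set mu C | C in [set C : set (OFilt K) | compact C /\ C `<=` U]]
    & forall B : set (borelOFilt K), measurable B ->
        mu B = ereal_inf
          [set mu U | U in [set U : set (OFilt K) | open U /\ B `<=` U]]].

Definition represents (R : realType) d (K : tLatticeType d)
    (mu : {measure set (borelOFilt K) -> \bar R}) (phi : K -> R) : Prop :=
  forall x : K, (phi x)%:E = mu [set V : OFilt K | ofilt_set V x].

(* [isLub] rather than the total operator [sup]: it also asserts that the
   supremum exists. *)
Definition scott_function (R : realType) d (K : tLatticeType d)
    (phi : K -> R) : Prop :=
  [/\ forall x, (0 <= phi x)%R,
      forall x, isLub [set phi z | z in [set z | way_below z x]] (phi x)
    & phi \top = 1%R].

Definition nabla1 (R : realType) d (K : tLatticeType d)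
    (phi : K -> R) (z : K) : K -> R :=
  fun x => (phi x - phi (x `&` z)%O)%R.

(* Successive differences along the enumeration of A; the result does not
   depend on the order of the enumeration. *)
Definition nabla (R : realType) d (K : tLatticeType d)
    (A : {fset K}) (phi : K -> R) : K -> R :=
  foldl (@nabla1 R d K) phi (enum_fset A).

Definition completely_monotone (R : realType) d (K : tLatticeType d)
    (phi : K -> R) : Prop :=
  {homo phi : x y / (x <= y)%O} /\
  forall A : {fset K}, A != fset0 -> forall x, (0 <= nabla A phi x)%R.

Definition prime_element d (K : tLatticeType d) (z : K) : Prop :=
  z <> \top /\ forall x y : K, z = (x `&` y)%O -> z = x \/ z = y.

Definition primeOFilt d (K : tLatticeType d) (k : nat) : set (OFilt K) :=
  [set V | exists A : {fset K},
    [/\ forall a, a \in A -> prime_element a,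
        (#|` A| <= k)%N
      & ofilt_set V = ~` down [set` A]]].

(* The restriction to {z | w << z}, landing in [set K] instead of OFilt(K);
   images and preimages are unaffected. *)
Definition truncation d (K : tLatticeType d) (w : K) (V : OFilt K) : set K :=
  ofilt_set V `&` [set z | way_below w z].

Definition lf_primeOFilt d (K : tLatticeType d) (w : nat -> K) :
    set (OFilt K) :=
  \bigcap_i \bigcup_(k in [set k | (0 < k)%N])
    truncation (w i) @^-1` (truncation (w i) @` @primeOFilt d K k).

(* Sublattices contain the top element, as substructures of a lattice with
   top; otherwise F = {w} would force phi w = 1 for every w in
   [locally_finite_valuation]. *)
Definition finite_sublattice d (K : tLatticeType d) (F : {fset K}) : Prop :=
  \top \in F /\
  forall x y, x \in F -> y \in F -> (x `&` y)%O \in F /\ (x `|` y)%O \in F.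

Definition fbottom d (K : tLatticeType d) (F : {fset K}) : K :=
  \meet_(z <- enum_fset F) z.

(* The maximal elements of {y in F | ~ x <= y}. *)
Definition max_not_above d (K : tLatticeType d) (F : {fset K}) (x : K) :
    {fset K} :=
  [fset y in F | ~~ (x <= y) &&
                 ~~ has (fun z => ~~ (x <= z) && (y < z)) (enum_fset F)]%fset.

Definition locally_finite_valuation (R : realType) d (K : tLatticeType d)
    (phi : K -> R) : Prop :=
  forall (w : K) (delta : R), (0 < delta)%R ->
  exists2 k : nat, (0 < k)%N &
    forall F : {fset K}, finite_sublattice F -> w <= fbottom F ->
    (1 - delta <= \sum_(x <- enum_fset F | (#|` max_not_above F x| <= k)%N)
                    nabla (max_not_above F x) phi x)%R.

(* Main.v *)
(* Call V in OFilt(K) n-scattered above w if some m_1, ..., m_n >> w lie outside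
   V while all their pairwise joins lie in V.  If V is n-scattered but not
   (n+1)-scattered, then for each j the y >> w with y v m_j outside V form an
   ideal; its supremum is a prime outside V, and these n primes cut out V above
   w.  Hence "V agrees above w with some member of P_k" means "V is not
   (k+1)-scattered above w", a Lawson closed condition.
   The sum defining a locally finite valuation is the measure of the V such that
   F \ V has at most k maximal elements.  Having more than k of them in some F
   above w is (k+1)-scatteredness, up to replacing >> by >=; since sublattices
   finitely generated above w are finite and form a directed family, compactness
   and inner regularity carry the bounds from single F to the open set of
   (k+1)-scattered V. *)
Require Import Defs.
From mathcomp Require Import all_boot all_order all_algebra finmap.
From mathcomp Require Import all_classical all_reals all_analysis.

Set Implicit Arguments.
Unset Strict Implicit.
Unset Printing Implicit Defensive.

Import Order.TTheory GRing.Theory Num.Theory.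

Local Open Scope ring_scope.
Local Open Scope order_scope.
Local Open Scope classical_set_scope.

(** * The way-below relation of a domain *)

Section WayBelow.
Variables (d : Order.disp_t) (K : porderType d).
Implicit Types x y z : K.

Lemma way_belowW x y : way_below x y -> x <= y.
Proof.
move=> /(_ [set y] y)[]//; last by move=> _ ->.
- by split; [exists y|move=> _ _ -> ->; exists y].
- by split=> [_ -> //|b]; apply.
Qed.

Lemma way_below_trans x y z : way_below x y -> y <= z -> way_below x z.
Proof. by move=> xy yz E s dE lE zs; apply: xy dE lE (le_trans yz zs). Qed.

Lemma le_way_below x y z : x <= y -> way_below y z -> way_below x z.
Proof.
move=> xy yz E s dE lE zs; have [v Ev yv] := yz E s dE lE zs.
by exists v => //; apply: le_trans yv.
Qed.

Hypothesis domK : is_domain K.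

Let way_belowE x : [/\ directed [set z | way_below z x],
  lower_set [set z | way_below z x] & isLub [set z | way_below z x] x].
Proof. by case: domK => _ /(_ x). Qed.

Lemma way_below_ub x y z : way_below x z -> way_below y z ->
  exists u, [/\ way_below u z, x <= u & y <= u].
Proof. by have [[_ ub] _ _] := way_belowE z; apply: ub. Qed.

Lemma way_below_lub x b : (forall z, way_below z x -> z <= b) -> x <= b.
Proof. by have [_ _ [_]] := way_belowE x; apply. Qed.

Lemma way_below_seq_ub (s : seq K) z :
  (forall x, x \in s -> way_below x z) ->
  exists2 u, way_below u z & forall x, x \in s -> x <= u.
Proof.
elim: s => [_|x s IHs sz].
  by have [[[u uz] _] _ _] := way_belowE z; exists u.
have [|u uz su] := IHs; first by move=> y ys; apply: sz; rewrite inE ys orbT.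
have [v [vz uv xv]] := way_below_ub uz (sz x (mem_head _ _)).
exists v => // y; rewrite inE => /predU1P[-> //|/su yu].
exact: le_trans uv.
Qed.

(** The set [E] of points two way-below steps under [z] is directed with supremum [z], so testing
    [way_below x z] against [E] yields the intermediate point. *)
Lemma way_below_interpolation x z : way_below x z ->
  exists2 y, way_below x y & way_below y z.
Proof.
pose E := [set t | exists2 u, way_below t u & way_below u z].
have dE : directed E.
  split.
    have [[[u uz] _] _ _] := way_belowE z.
    by have [[[t tu] _] _ _] := way_belowE u; exists t, u.
  move=> t1 t2 [u1 tu1 uz1] [u2 tu2 uz2].
  have [u [uz u1u u2u]] := way_below_ub uz1 uz2.
  have [t [tu t1t t2t]] :=
    way_below_ub (way_below_trans tu1 u1u) (way_below_trans tu2 u2u).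
  by exists t; split=> //; exists u.
have lE : isLub E z.
  split=> [t [u /way_belowW tu /way_belowW uz]|b Eb]; first exact: le_trans uz.
  apply: way_below_lub => u uz; apply: way_below_lub => t tu.
  by apply: Eb; exists u.
move=> /(_ E z dE lE (lexx z))[t [u tu uz] xt].
by exists u => //; apply: le_way_below tu.
Qed.

Lemma scott_open_way_below (V : set K) x : scott_open V -> V x ->
  exists2 a, V a & way_below a x.
Proof.
move=> [_ Vdir] Vx; have [dx _ lx] := way_belowE x.
by have [a ax Va] := Vdir _ _ dx lx Vx; exists a.
Qed.

Lemma scott_open_way_above x : scott_open [set z | way_below x z].
Proof.
split=> [y z xy yz|E s dE lE /way_below_interpolation[y xy ys]].
  exact: way_below_trans yz.
have [z Ez yz] := ys E s dE lE (lexx s).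
by exists z => //; apply: way_below_trans yz.
Qed.

End WayBelow.

(** * Scott open filters and their Lawson topology *)

Section OpenFilters.
Variables (d : Order.disp_t) (K : tLatticeType d).
Implicit Types (x y z a : K) (V W : OFilt K).

Lemma ofiltP V : scott_open_filter V.
Proof. exact/asboolP/ofilt_setP. Qed.

Lemma ofilt_scott_open V : scott_open V.
Proof. by have [] := ofiltP V. Qed.

Lemma ofilt_upper V x y : ofilt_set V x -> x <= y -> ofilt_set V y.
Proof. by have [[/(_ x y)]] := ofiltP V. Qed.

Lemma ofilt_top V : ofilt_set V \top.
Proof.
by have [_ [[x Vx] _]] := ofiltP V; apply: ofilt_upper Vx (lex1 x).
Qed.

Lemma ofiltI V x y : ofilt_set V x -> ofilt_set V y -> ofilt_set V (x `&` y)%O.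
Proof.
have [_ [_ dV]] := ofiltP V => Vx Vy; have [z [Vz zx zy]] := dV x y Vx Vy.
by apply: ofilt_upper Vz _; rewrite lexI zx.
Qed.

Lemma scott_open_filterP (V : set K) : scott_open V -> V \top ->
  (forall x y, V x -> V y -> V (x `&` y)%O) -> scott_open_filter V.
Proof.
move=> oV V1 VI; split=> //; split=> [|x y Vx Vy]; first by exists \top.
by exists (x `&` y)%O; split; [apply: VI|apply: leIl|apply: leIr].
Qed.

Lemma ofilt_bigcup (E : set (OFilt K)) : directed E ->
  scott_open_filter (\bigcup_(V in E) ofilt_set V).
Proof.
move=> [[V0 EV0] dE]; apply: scott_open_filterP.
- split=> [x y [V EV Vx] xy|D s dD lD [V EV Vs]].
    by exists V => //; apply: ofilt_upper Vx xy.
  have [_ /(_ D s dD lD Vs)[z Dz Vz]] := ofilt_scott_open V.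
  by exists z => //; exists V.
- by exists V0 => //; apply: ofilt_top.
- move=> x y [V EV Vx] [W EW Wy]; have [U [EU VU WU]] := dE V W EV EW.
  move: VU WU; rewrite !le_ofiltE => /asboolP VU /asboolP WU.
  by exists U => //; apply: ofiltI; [apply: VU|apply: WU].
Qed.

Lemma open_lawson_subbase (U : set (OFilt K)) : lawson_subbase U -> open U.
Proof.
move=> sU; exists [set U]; last by rewrite bigcup_set1.
by move=> _ ->; apply: finI_from1.
Qed.

(** The supremum of a directed family lies below its union, which is an open filter by
    [ofilt_bigcup]; hence a point of the supremum already lies in some member. *)
Lemma open_ofilt_mem x : open [set V : OFilt K | ofilt_set V x].
Proof.
apply: open_lawson_subbase; left; split=> [V W Vx|E S dE [_ lS] /= Sx].
  by rewrite le_ofiltE => /asboolP; apply.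
have : S <= MkOFilt (asboolT (ofilt_bigcup dE)).
  by apply: lS => V EV; rewrite le_ofiltE; apply/asboolP => y Vy; exists V.
by rewrite le_ofiltE => /asboolP /(_ x Sx)[V EV Vx]; exists V.
Qed.

Hypothesis domK : is_domain K.
Hypothesis top_compact : way_below (\top : K) (\top : K).
Hypothesis mulK : way_below_multiplicative K.

(** Compactness of [\top] puts the top into this set and multiplicativity closes it under meets. As
    an element of OFilt(K) it supplies the Lawson open sets of the second kind. *)
Lemma way_above_filter a : scott_open_filter [set z | way_below a z].
Proof.
apply: scott_open_filterP; first exact: scott_open_way_above.
  by apply: le_way_below top_compact; apply: lex1.
by move=> x y ax ay /=; rewrite -[a]meetxx; apply: mulK.
Qed.

Lemma open_not_way_above a :
  open [set V : OFilt K | exists2 y, way_below a y & ~ ofilt_set V y].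
Proof.
pose A := MkOFilt (asboolT (way_above_filter a)).
rewrite [X in open X](_ : _ = ~` principal_upper A); last first.
  apply/seteqP; split=> V.
    move=> [y ay nVy]; rewrite /principal_upper/= le_ofiltE => /asboolP AV.
    exact/nVy/AV.
  apply: contra_notP => nV; rewrite /principal_upper/= le_ofiltE.
  apply/asboolP => y ay; apply: contrapT => nVy; apply: nV.
  by exists y.
by apply: open_lawson_subbase; right; exists A.
Qed.

(** Take [a] in [V] way below [x]: one side asks for [a] inside the filter, the other for some point
    way above [a] outside it, and upward closure makes these incompatible. *)
Lemma ofilt_sub_separated V W x : ofilt_set V x -> ~ ofilt_set W x ->
  exists2 AB : set (OFilt K) * set (OFilt K), AB.1 V /\ AB.2 W &
   [/\ open AB.1, open AB.2 & AB.1 `&` AB.2 = set0].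
Proof.
move=> Vx nWx.
have [a Va ax] := scott_open_way_below domK (ofilt_scott_open V) Vx.
exists ([set U : OFilt K | ofilt_set U a],
        [set U : OFilt K | exists2 y, way_below a y & ~ ofilt_set U y]) => /=.
  by split=> //; exists x.
split; [exact: open_ofilt_mem|exact: open_not_way_above|].
apply/seteqP; split=> // U [/= Ua [y /way_belowW ay nUy]].
by apply: nUy; apply: ofilt_upper Ua ay.
Qed.

(** Serves to make compact sets closed, hence Borel, when inner regularity is applied. *)
Lemma hausdorff_ofilt : hausdorff_space (OFilt K).
Proof.
rewrite open_hausdorff => V W /eqP VW.
have [x [[Vx nWx]|[Wx nVx]]] : exists x, ofilt_set V x /\ ~ ofilt_set W x \/
    ofilt_set W x /\ ~ ofilt_set V x.
- apply: contra_notP VW => /forallNP nVW; apply/val_inj/seteqP; split=> x Vx.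
    by apply: contrapT => nWx; case: (nVW x); left.
  by apply: contrapT => nWx; case: (nVW x); right.
- have [AB [AV BW] [oA oB AB0]] := ofilt_sub_separated Vx nWx.
  by exists AB; [rewrite !inE|split=> //; apply/eqP].
- have [AB [AV BW] [oA oB AB0]] := ofilt_sub_separated Wx nVx.
  exists (AB.2, AB.1); first by rewrite !inE.
  by split=> //=; apply/eqP; rewrite setIC.
Qed.

Lemma compact_measurable (C : set (OFilt K)) : compact C ->
  measurable (C : set (borelOFilt K)).
Proof.
move=> /(compact_closed hausdorff_ofilt) clC.
rewrite -[C]setCK; apply: measurableC; apply: sub_sigma_algebra.
exact: closed_openC.
Qed.

End OpenFilters.

Lemma open_forall (T : topologicalType) (I : finType) (P : I -> set T) :
  (forall i, open (P i)) -> open [set x | forall i, P i x].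
Proof.
move=> oP; rewrite (_ : mkset _ = \big[setI/setT]_(i <- enum I) P i).
  by apply: big_ind => //; [exact: openT|exact: openI].
rewrite -bigcap_seq; apply/seteqP; split=> x Px i; first by move=> _.
by apply: Px; rewrite /= mem_enum.
Qed.

(** * Scattered filters, primes, and openness of scatteredness *)

Section Scattered.
Variables (d : Order.disp_t) (K : tDistrLatticeType d).
Implicit Types (w x y z : K) (V W : OFilt K).

(** Such an [m] is injective, since a repeated value would be its own join and so lie in [V]; thus
    [n] counts actual points. *)
Definition scattering w V n (m : 'I_n -> K) :=
  [/\ forall i, way_below w (m i), forall i, ~ ofilt_set V (m i)
    & forall i j, i != j -> ofilt_set V (m i `|` m j)%O].

Definition scattered w n : set (OFilt K) :=
  [set V | exists m : 'I_n -> K, scattering w V m].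

Lemma scattered0 w V : scattered w 0 V.
Proof. by exists (fun=> \top); split=> [[]|[]|[]]. Qed.

Lemma scatteredS w n : scattered w n.+1 `<=` scattered w n.
Proof.
move=> V [m [wm nVm Vm]]; exists (m \o widen_ord (leqnSn n)).
by split=> [i|i|i j ij]; [apply: wm|apply: nVm|apply: Vm].
Qed.

Lemma scattered_cons w V n (m : 'I_n -> K) y : scattering w V m ->
  way_below w y -> ~ ofilt_set V y ->
  (forall i, ofilt_set V (y `|` m i)%O) -> scattered w n.+1 V.
Proof.
move=> [wm nVm Vm] wy nVy Vy.
exists (fun i => if unlift ord0 i is Some j then m j else y); split=> [i|i|i j].
- by case: unliftP.
- by case: unliftP.
- case: (unliftP ord0 i) => [i' ->|->]; case: (unliftP ord0 j) => [j' ->|->].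
  + by rewrite (inj_eq lift_inj) => /Vm.
  + by rewrite joinC.
  + by [].
  + by rewrite eqxx.
Qed.

(* Two members [y], [z] with [y `|` m j], [z `|` m j] outside [V] but their
   join inside would split [m j] in two. *)
Lemma scattering_ideal w V n (m : 'I_n -> K) j y z : scattering w V m ->
  ~ scattered w n.+1 V ->
  ~ ofilt_set V (y `|` m j)%O -> ~ ofilt_set V (z `|` m j)%O ->
  ~ ofilt_set V ((y `|` z) `|` m j)%O.
Proof.
move=> [wm nVm Vm] nS nVy nVz Vyz; apply: nS.
pose m1 i := if i == j then (y `|` m j)%O else m i.
apply: (@scattered_cons _ _ _ m1 (z `|` m j)%O).
- split=> [i|i|i i']; rewrite /m1.
  + by case: ifP => _ //; apply: way_below_trans (wm j) (leUr _ _).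
  + by case: ifP.
  + move=> ii'; case: (eqVneq i j) => [ij|ij]; case: (eqVneq i' j) => [i'j|i'j].
    * by rewrite ij i'j eqxx in ii'.
    * apply: ofilt_upper (Vm _ _ ii') _.
      by rewrite ij leU2// leUr.
    * apply: ofilt_upper (Vm _ _ ii') _.
      by rewrite i'j leU2// leUr.
    * exact: Vm.
- exact: way_below_trans (wm j) (leUr _ _).
- by [].
- move=> i; rewrite /m1; case: eqVneq => [_|ij].
    apply: ofilt_upper Vyz _; rewrite !leUx.
    by rewrite (le_trans _ (leUr _ _)) ?leUl//= (le_trans _ (leUl _ _)) ?leUl//=
      (le_trans _ (leUl _ _)) ?leUr.
  apply: ofilt_upper (Vm _ _ ij) _.
  by rewrite joinC leU2// leUr.
Qed.

Lemma finite_prime_ofilt (A : {fset K}) :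
  (forall a, a \in A -> prime_element a) ->
  scott_open_filter (~` down [set` A]).
Proof.
move=> primeA; apply: scott_open_filterP.
- split=> [x y nAx xy /downP[a Aa ya]|E s [[e0 Ee0] dE] [_ lE] nAs].
    by apply: nAx; apply/downP; exists a => //; apply: le_trans ya.
  (* [s] is below no [a] in [A], so each [a] fails to bound some point of [E];
     by directedness a single point of [E] escapes all of them. *)
  apply: contrapT => nE.
  have Ebelow a : a \in A -> exists e, E e /\ ~~ (e <= a).
    move=> Aa; apply: contrapT => /forallNP na; apply: nAs; apply/downP.
    exists a => //; apply: lE => e Ee; apply: contrapT => /negP nea.
    by apply: (na e).
  have [e Ee eA] : exists2 e, E e & forall a, a \in enum_fset A -> ~~ (e <= a).
    have : {subset enum_fset A <= A} by [].
    elim: (enum_fset A) => [_|a s0 IHs sA]; first by exists e0.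
    have [|e Ee es] := IHs.
      by move=> b bs; apply: sA; rewrite inE bs orbT.
    have [e' [Ee' e'a]] := Ebelow a (sA _ (mem_head _ _)).
    have [e2 [Ee2 ee2 e'e2]] := dE _ _ Ee Ee'.
    exists e2 => // b; rewrite inE => /predU1P[->|/es].
      by apply: contra e'a; apply: le_trans.
    by apply: contra; apply: le_trans.
  apply: nE; exists e => //= /downP[a Aa ea].
  by have := eA a Aa; rewrite ea.
- move=> /downP[a Aa]; rewrite le1x => /eqP aT.
  by have [] := primeA a Aa.
- move=> x y nAx nAy /downP[a Aa xya]; have [_ pa] := primeA a Aa.
  (* Distributivity turns meet-irreducibility of [a] into: a meet below [a] has a factor below
     [a]. *)
  have : a = ((a `|` x) `&` (a `|` y))%O by rewrite -joinIr; apply/esym/join_l.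
  move=> /pa[] ax; [apply: nAx|apply: nAy]; apply/downP; exists a => //.
    by rewrite ax leUr.
  by rewrite ax leUr.
Qed.

Hypothesis domK : is_domain K.

Lemma scattering_maximal_prime w V n (m : 'I_n -> K) : scattering w V m ->
  ~ scattered w n.+1 V ->
  exists2 W, primeOFilt n W & truncation w W = truncation w V.
Proof.
move=> sm nS; have [wm nVm Vm] := sm.
(* The ideal attached to [m j]; its supremum [a j] will be the prime. *)
pose I j := [set y | way_below w y /\ ~ ofilt_set V (y `|` m j)%O].
have Im j : I j (m j) by split=> //; rewrite joinxx.
have dI j : directed (I j).
  split=> [|y z [wy nVy] [wz nVz]]; first by exists (m j).
  exists (y `|` z)%O; split; [|exact: leUl|exact: leUr].
  split; first exact: way_below_trans wy (leUl _ _).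
  exact: scattering_ideal sm nS nVy nVz.
have /choice[a aP] : forall j, exists s, isLub (I j) s.
  by move=> j; case: domK => + _; apply.
have Ia j y : I j y -> y <= a j by case: (aP j) => + _; apply.
(* Scott openness: if the supremum were in [V], a member of [I j] would be too. *)
have nVa j : ~ ofilt_set V (a j).
  have [_ Vd] := ofilt_scott_open V.
  move=> /(Vd _ _ (dI j) (aP j))[y [_ nVy] Vy].
  by apply: nVy; apply: ofilt_upper Vy (leUl _ _).
(* A point [y] in none of the ideals would extend [m] to a scattering of size [n.+1]. *)
have outE y : way_below w y -> ~ ofilt_set V y -> exists j, y <= a j.
  move=> wy nVy; have [j nVyj] : exists j, ~ ofilt_set V (y `|` m j)%O.
    by apply/existsNP => Vy; apply: nS; apply: scattered_cons sm wy nVy Vy.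
  by exists j; apply: Ia.
(* [a j] is maximal outside [V], because such an [x] is above [m j] and so belongs to [I j].
   Maximality outside a filter gives primeness. *)
have ge_a j x : a j <= x -> ~ ofilt_set V x -> x = a j.
  move=> ax nVx; have mx := le_trans (Ia j _ (Im j)) ax.
  apply: le_anti; rewrite ax andbT Ia//; split.
    exact: way_below_trans (wm j) mx.
  by rewrite join_l.
have primea j : prime_element (a j).
  split=> [aT|x y axy]; first by apply: (nVa j); rewrite aT; apply: ofilt_top.
  have [ax ay] : a j <= x /\ a j <= y by rewrite axy leIl leIr.
  case: (pselect (ofilt_set V x)) => [Vx|/(ge_a _ _ ax)->]; last by left.
  case: (pselect (ofilt_set V y)) => [Vy|/(ge_a _ _ ay)->]; last by right.
  by case: (nVa j); rewrite axy; apply: ofiltI.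
pose A := [fset a j | j : 'I_n]%fset.
have primeA b : b \in A -> prime_element b by move=> /imfsetP[j _ ->].
exists (MkOFilt (asboolT (finite_prime_ofilt primeA))).
  exists A; split=> //; apply: leq_trans (leq_imfset_card _ _ _) _.
  by rewrite /= -cardE card_ord.
apply/seteqP; split=> y [/= Wy wy]; split=> //.
  apply: contrapT => nVy; have [j ya] := outE y wy nVy.
  by apply: Wy; apply/downP; exists (a j) => //; apply/imfsetP; exists j.
move=> /downP[_ /imfsetP[j _ ->] ya].
by apply: (nVa j); apply: ofilt_upper Wy ya.
Qed.

Lemma primeOFilt_le k n : (k <= n)%N ->
  @primeOFilt d K k `<=` @primeOFilt d K n.
Proof.
move=> kn V [A [pA Ak VA]]; exists A; split=> //.
exact: leq_trans kn.
Qed.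

(** Forwards, take the [n <= k] at which scatteredness stops. Backwards, of [k.+1] scattered points
    two would lie below the same one of at most [k] primes, and then so would their join, which is
    in [V]. *)
Lemma not_scatteredP w k V : ~ scattered w k.+1 V <->
  (truncation w @^-1` (truncation w @` @primeOFilt d K k)) V.
Proof.
split=> [nS|[W [A [_ Ak WA]] WV] [m [wm nVm Vm]]].
  have [n [nk [m sm] nSn]] : exists n,
      [/\ (n <= k)%N, scattered w n V & ~ scattered w n.+1 V].
    elim: k nS => [|k IHk] nS.
      by exists 0%N; split=> //; apply: scattered0.
    have [Sk|/IHk[n [nk Sn nSn]]] := pselect (scattered w k.+1 V).
      by exists k.+1.
    by exists n; split=> //; apply: leqW.
  have [W Wn WV] := scattering_maximal_prime sm nSn.
  by exists W => //; apply: primeOFilt_le Wn.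
have outW y : way_below w y -> ~ ofilt_set V y -> ~ ofilt_set W y.
  move=> wy nVy Wy; apply: nVy.
  by have [] : truncation w V y by rewrite -WV.
have /choice[b bP] : forall i, exists b, b \in A /\ m i <= b.
  move=> i; have := outW _ (wm i) (nVm i).
  by rewrite WA => /contrapT/downP[b Ab mb]; exists b.
have b_inj : injective b.
  move=> i j bij; apply/eqP/negPn/negP => /Vm Vij.
  have : truncation w W (m i `|` m j)%O.
    by rewrite WV; split=> //; apply: way_below_trans (wm i) (leUl _ _).
  move=> []; rewrite WA => + _; apply; apply/downP; exists (b i).
    by have [] := bP i.
  by rewrite leUx (bP i).2 bij (bP j).2.
have : (size [seq b i | i <- enum 'I_k.+1] <= size (enum_fset A))%N.
  apply: uniq_leq_size; first by rewrite map_inj_uniq ?enum_uniq.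
  by move=> _ /mapP[i _ ->]; have [] := bP i.
by rewrite size_map size_enum_ord leqNgt ltnS Ak.
Qed.

(** From here on primes disappear: the set is described by complements of scattered sets, which are
    open by [open_scattered]. *)
Lemma lf_primeOFiltE (w : nat -> K) : lf_primeOFilt w =
  \bigcap_i \bigcup_(k in [set k | (0 < k)%N]) ~` scattered (w i) k.+1.
Proof.
by apply/seteqP; split=> V PV i _; have [k k0 Vk] := PV i I; exists k => //;
  apply/not_scatteredP.
Qed.

(** A point outside [V] is not a Lawson open condition, but having one way above [a i] is. So [a]
    stands slightly below a scattering, and the joins are demanded already of [a]. *)
Definition scattered_nbhd n (a : 'I_n -> K) : set (OFilt K) :=
  [set V | (forall i, exists2 y, way_below (a i) y & ~ ofilt_set V y) /\
     forall i j, i != j -> ofilt_set V (a i `|` a j)%O].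

Lemma scattered_nbhd_out n (a : 'I_n -> K) V i :
  scattered_nbhd a V -> ~ ofilt_set V (a i).
Proof.
move=> [+ _] Va => /(_ i)[y /way_belowW ay]; apply.
exact: ofilt_upper ay.
Qed.

(** Since [V] is Scott open, each join [m i]|[m j] can be lowered to a join of points way below
    [m i] and [m j]; [a i] then bounds the finitely many points needed under [m i]. In return
    [w <= a i] suffices, which matches the bound on sublattices. *)
Lemma scattered_bigcup w n : scattered w n =
  \bigcup_(a in [set a : 'I_n -> K | forall i, w <= a i]) scattered_nbhd a.
Proof.
apply/seteqP; split=> V; last first.
  move=> [a wa [/= aV Va]].
  have /choice[m mP] : forall i, exists y, way_below (a i) y /\ ~ ofilt_set V y.
    by move=> i; have [y] := aV i; exists y.
  exists m; split=> [i|i|i j ij]; [|by have [] := mP i|].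
    by have [am _] := mP i; apply: le_way_below (wa i) am.
  apply: ofilt_upper (Va _ _ ij) _.
  by apply: leU2; apply: way_belowW; [have [] := mP i|have [] := mP j].
move=> [m [wm nVm Vm]].
have /choice[b bP] : forall ij : 'I_n * 'I_n, exists b : K * K,
    [/\ way_below b.1 (m ij.1), way_below b.2 (m ij.2) &
        ij.1 != ij.2 -> ofilt_set V (b.1 `|` b.2)%O].
  move=> [i j] /=; case: eqVneq => [_|ij].
    (* On the diagonal no join is required, and [w] is a harmless default way below every [m i]. *)
    by exists (w, w).
  pose E := [set t | exists b : K * K,
    [/\ way_below b.1 (m i), way_below b.2 (m j) & t = (b.1 `|` b.2)%O]].
  have dE : directed E.
    split; first by exists (w `|` w)%O, (w, w).
    move=> _ _ [[b1 b2] [/= b1m b2m ->]] [[c1 c2] [/= c1m c2m ->]].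
    have [u [um b1u c1u]] := way_below_ub domK b1m c1m.
    have [v [vm b2v c2v]] := way_below_ub domK b2m c2m.
    by exists (u `|` v)%O; split; [exists (u, v)|exact: leU2|exact: leU2].
  have lE : isLub E (m i `|` m j)%O.
    split=> [_ [b [/way_belowW b1 /way_belowW b2 ->]]|c Ec]; first exact: leU2.
    rewrite leUx; apply/andP; split; apply: (way_below_lub domK) => z zm.
      by apply: le_trans (leUl z w) _; apply: Ec; exists (z, w).
    by apply: le_trans (leUr z w) _; apply: Ec; exists (w, z).
  have [_ Vdir] := ofilt_scott_open V.
  have [_ [c [c1 c2 ->]] Vc] := Vdir E _ dE lE (Vm _ _ ij).
  by exists c.
have /choice[a aP] : forall i, exists a, [/\ way_below a (m i), w <= a,
    forall j, (b (i, j)).1 <= a & forall j, (b (j, i)).2 <= a].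
  move=> i; have [|u um uP] := @way_below_seq_ub _ _ domK
      [seq (b (i, j)).1 | j <- enum 'I_n] (m i).
    by move=> _ /mapP[j _ ->]; have [] := bP (i, j).
  have [|v vm vP] := @way_below_seq_ub _ _ domK
      [seq (b (j, i)).2 | j <- enum 'I_n] (m i).
    by move=> _ /mapP[j _ ->]; have [] := bP (j, i).
  have [t [tm ut vt]] := way_below_ub domK um vm.
  have [a [am ta wa]] := way_below_ub domK tm (wm i).
  exists a; split=> // j; apply: le_trans ta.
    by apply: le_trans ut; apply: uP; apply: map_f; rewrite mem_enum.
  by apply: le_trans vt; apply: vP; apply: map_f; rewrite mem_enum.
exists a => [i|]; first by have [] := aP i.
split=> [i|i j ij]; first by exists (m i) => //; have [] := aP i.
have [_ _ Vb] := bP (i, j); apply: ofilt_upper (Vb ij) _.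
by apply: leU2; [have [_ _ ->] := aP i|have [_ _ _ ->] := aP j].
Qed.

Hypothesis top_compact : way_below (\top : K) (\top : K).
Hypothesis mulK : way_below_multiplicative K.

Lemma open_scattered_nbhd n (a : 'I_n -> K) : open (scattered_nbhd a).
Proof.
rewrite [X in open X](_ : _ =
  [set V | forall i, exists2 y, way_below (a i) y & ~ ofilt_set V y] `&`
  [set V | forall ij : 'I_n * 'I_n, ij.1 = ij.2 \/
     ofilt_set V (a ij.1 `|` a ij.2)%O]).
  apply: openI; apply: open_forall => i; first exact: open_not_way_above.
  case: (eqVneq i.1 i.2) => [->|/eqP ni].
    rewrite [X in open X](_ : _ = setT); first exact: openT.
    by apply/seteqP; split=> // V _; left.
  rewrite [X in open X](_ : _ = [set V | ofilt_set V (a i.1 `|` a i.2)%O]).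
    exact: open_ofilt_mem.
  by apply/seteqP; split=> V /=; [case|right].
apply/seteqP; split=> V [/= Va Vaa]; split=> //.
  by move=> [i j] /=; case: (eqVneq i j) => [->|/Vaa]; [left|right].
by move=> i j /eqP ij; have /= [] := Vaa (i, j).
Qed.

Lemma open_scattered w n : open (scattered w n).
Proof.
by rewrite scattered_bigcup; apply: bigcup_open => a _;
  apply: open_scattered_nbhd.
Qed.

End Scattered.

(** * Finite sublattices and the strata they cut out *)

Section FiniteSublattices.
Variables (d : Order.disp_t) (K : tDistrLatticeType d).
Implicit Types (w x y z : K) (V : OFilt K) (F : {fset K}).

(** By induction on [s]: adjoining [t] to [F] gives the elements [(a]&[t)]|[b] with [a], [b] in [F],
    closed under both operations by distributivity. Keeping [w] in [F] as its bottom lets [a := w]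
    recover [F] and [b := w] recover [t]. *)
Lemma finite_sublattice_generated w (s : seq K) :
  (forall z, z \in s -> w <= z) -> exists F,
  [/\ finite_sublattice F, forall z, z \in F -> w <= z & {subset s <= F}].
Proof.
move=> ws; suff [F [sF wF _ subF]] : exists F, [/\ finite_sublattice F,
    forall z, z \in F -> w <= z, w \in F & {subset s <= F}] by exists F.
elim: s ws => [_|t s IHs ws].
  exists [fset \top; w]%fset; split=> [|z|//|]; last 2 first.
  - by rewrite !inE eqxx orbT.
  - by [].
  - split=> [|x y]; first by rewrite !inE eqxx.
    by rewrite !inE => /orP[]/eqP-> /orP[]/eqP->;
      rewrite ?meetxx ?joinxx ?meet1x ?meetx1 ?join1x ?joinx1 ?eqxx ?orbT.
  - by rewrite !inE => /orP[]/eqP->; rewrite ?lex1.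
have [|F [[F1 FIU] wF Fw subF]] := IHs.
  by move=> z zs; apply: ws; rewrite inE zs orbT.
have wt : w <= t by apply: ws; rewrite inE eqxx.
pose f (ab : K * K) := ((ab.1 `&` t) `|` ab.2)%O.
have inF' z : reflect (exists a b, [/\ a \in F, b \in F & z = f (a, b)])
    (z \in [fset f (a, b) | a in F, b in F]%fset).
  apply: (iffP idP) => [/imfset2P[a aF [b bF ->]]|[a [b [aF bF ->]]]].
    by exists a, b.
  by apply/imfset2P; exists a => //; exists b.
have FF' z : z \in F -> z \in [fset f (a, b) | a in F, b in F]%fset.
  move=> zF; apply/inF'; exists w, z; split=> //; rewrite /f/=.
  by rewrite meet_l// join_r// wF.
exists [fset f (a, b) | a in F, b in F]%fset; split.
- split=> [|x y /inF'[a [b [aF bF ->]]] /inF'[a' [b' [a'F b'F ->]]]].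
    exact: FF'.
  split; apply/inF'.
    (* The coefficients found by expanding the meet of the two forms and collecting the terms that
       contain [t]. *)
    exists (((a `&` a') `|` (b `&` a')) `|` (a `&` b'))%O, (b `&` b')%O.
    split; last by rewrite /f /= meetUr !meetUl meetACA meetxx meetA
      [((a `&` t) `&` b')%O]meetAC !joinA.
      apply: (FIU _ _ _ _).2; last exact: (FIU _ _ _ _).1.
      by apply: (FIU _ _ _ _).2; apply: (FIU _ _ _ _).1.
    exact: (FIU _ _ _ _).1.
  exists (a `|` a')%O, (b `|` b')%O; split.
  + exact: (FIU _ _ _ _).2.
  + exact: (FIU _ _ _ _).2.
  + by rewrite /f /= meetUl joinACA.
- move=> _ /inF'[a [b [aF bF ->]]].
  by apply: le_trans (leUr _ _); apply: wF.
- exact: FF'.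
- move=> z; rewrite inE => /predU1P[->|/subF]; last exact: FF'.
  apply/inF'; exists \top, w; split=> //.
  by rewrite /f /= meet1x join_l.
Qed.

Lemma le_fbottom w F : w <= fbottom F -> forall z, z \in F -> w <= z.
Proof. by move=> /meetsP_seq wF z zF; apply: wF. Qed.

Lemma fbottom_ge w F : (forall z, z \in F -> w <= z) -> w <= fbottom F.
Proof. by move=> wF; apply/meetsP_seq => z zF _; apply: wF. Qed.

Lemma max_not_aboveP F x y : reflect [/\ y \in F, ~~ (x <= y) &
    forall z, z \in F -> ~~ (x <= z) -> y <= z -> y = z]
  (y \in max_not_above F x).
Proof.
rewrite !inE; apply: (iffP and3P) => [[yF xy /hasPn my]|[yF xy my]]; split=> //.
  move=> z zF xz yz; apply/eqP; apply: contraT => neyz.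
  by have := my z zF; rewrite xz lt_neqAle neyz yz.
apply/hasPn => z zF; rewrite negb_and negbK orbC -implyNb negbK; apply/implyP.
move=> yz; apply: contraT => xz; move: (yz).
by rewrite -(my z zF xz (ltW yz)) ltxx.
Qed.

(** Climbs from [y] while it is not maximal; the number of elements of [F] strictly above
    decreases. *)
Lemma max_not_above_ge F x y : y \in F -> ~~ (x <= y) ->
  exists2 b, b \in max_not_above F x & y <= b.
Proof.
have [n] := ubnP (size [seq z <- enum_fset F | y < z]).
elim: n y => // n IHn y szy yF xy.
have [my|nmy] := boolP (y \in max_not_above F x); first by exists y.
have [z [zF xz yz]] : exists z, [/\ z \in F, ~~ (x <= z) & y < z].
  move: nmy; rewrite !inE yF xy /= negbK => /hasP[z zF /andP[xz yz]].
  by exists z.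
have [|b bm zb] := IHn z _ zF xz; last first.
  by exists b => //; apply: le_trans (ltW yz) zb.
move: szy; rewrite ltnS; apply: leq_trans.
apply: (@uniq_leq_size _ (z :: [seq t <- enum_fset F | z < t])) => [|t] /=.
  by rewrite mem_filter ltxx /= filter_uniq ?fset_uniq.
rewrite inE !mem_filter => /predU1P[->|/andP[zt ->]]; first by rewrite yz.
by rewrite (lt_trans yz zt).
Qed.

(** For [x] in [F] these are the [V] whose trace on [F] is the principal filter of [x];
    [max_not_above F x] is then the set of maximal elements of [F] outside [V]. *)
Definition stratum F x : set (OFilt K) :=
  [set V | ofilt_set V x /\
     forall b, b \in max_not_above F x -> ~ ofilt_set V b].

Lemma stratum_le F x V y : stratum F x V -> y \in F -> ofilt_set V y -> x <= y.
Proof.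
move=> [Vx nV] yF Vy; apply: contraT => /(max_not_above_ge yF)[b bm yb].
by case: (nV b bm); apply: ofilt_upper Vy yb.
Qed.

Lemma stratum_inj F x y V : x \in F -> y \in F ->
  stratum F x V -> stratum F y V -> x = y.
Proof.
move=> xF yF Vx Vy; apply: le_anti; apply/andP; split.
  by apply: stratum_le Vx yF _; case: Vy.
by apply: stratum_le Vy xF _; case: Vx.
Qed.

(** The index is the meet of all members of [F] lying in [V]. *)
Lemma stratum_cover F V : finite_sublattice F ->
  exists2 x, x \in F & stratum F x V.
Proof.
move=> [F1 FIU].
pose x := (\meet_(z <- enum_fset F | `[< ofilt_set V z >]) z)%O.
have [xF Vx] : x \in F /\ ofilt_set V x.
  rewrite /x big_seq_cond.
  elim/big_ind: _ => [|y z [yF Vy] [zF Vz]|y /andP[yF /asboolP Vy]] //.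
    by split=> //; apply: ofilt_top.
  by split; [exact: (FIU _ _ _ _).1|exact: ofiltI].
exists x => //; split=> // b /max_not_aboveP[bF /negP xb _] Vb.
by apply: xb; apply: meets_inf_seq => //; apply/asboolP.
Qed.

(** Two distinct maximal elements of [F] outside [V] have their join in [F] and, by maximality,
    above [x], hence in [V]. The first [k.+1] of them form a scattering; the default of [nth] is
    never reached. *)
Lemma stratum_scattered w F x V k : finite_sublattice F ->
  (forall z, z \in F -> way_below w z) -> stratum F x V ->
  (k < #|` max_not_above F x|)%N -> scattered w k.+1 V.
Proof.
move=> [_ FIU] wF xV ltk; have [_ nV] := xV.
pose m (i : 'I_k.+1) := nth \top (enum_fset (max_not_above F x)) i.
have mM i : m i \in max_not_above F x.
  by apply: mem_nth; apply: leq_trans ltk; apply: ltn_ord.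
exists m; split=> [i|i|i j ij]; [|exact: nV|].
  by apply: wF; have /max_not_aboveP[] := mM i.
have /max_not_aboveP[iF xi maxi] := mM i.
have /max_not_aboveP[jF xj maxj] := mM j.
have ijF := (FIU _ _ iF jF).2.
have xij : x <= (m i `|` m j)%O.
  apply: contraT => nx; have mij : m i = m j.
    rewrite (maxi _ ijF nx (leUl _ _)).
    by rewrite [RHS](maxj _ ijF nx (leUr _ _)).
  move: ij; rewrite -(inj_eq val_inj) /=.
  rewrite -(nth_uniq \top _ _ (fset_uniq (max_not_above F x))).
  - by rewrite -/(m i) -/(m j) mij eqxx.
  - by apply: leq_trans ltk; apply: ltn_ord.
  - by apply: leq_trans ltk; apply: ltn_ord.
by apply: ofilt_upper xij; case: xV.
Qed.

(** Each [a i] lies below a maximal element of [F] outside [V], and two of them cannot share one,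
    since their join is in [V]. *)
Lemma scattered_nbhd_stratum n (a : 'I_n -> K) F x V :
  (forall i, a i \in F) -> scattered_nbhd a V -> stratum F x V ->
  (n <= #|` max_not_above F x|)%N.
Proof.
move=> aF Va [Vx nV].
have /choice[b bP] : forall i, exists b, b \in max_not_above F x /\ a i <= b.
  move=> i; have [|b bm ab] := @max_not_above_ge F x (a i) (aF i).
    apply/negP => xa; apply: (@scattered_nbhd_out _ _ _ _ _ i Va).
    exact: ofilt_upper xa.
  by exists b.
have b_inj : injective b.
  move=> i j bij; apply/eqP/negPn/negP => ij; have [bm ab] := bP i.
  apply: (nV _ bm); have [_ /(_ i j ij) Vij] := Va; apply: ofilt_upper Vij _.
  by rewrite leUx ab bij (bP j).2.
have : (size [seq b i | i <- enum 'I_n] <=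
        size (enum_fset (max_not_above F x)))%N.
  apply: uniq_leq_size; first by rewrite map_inj_uniq ?enum_uniq.
  by move=> _ /mapP[i _ ->]; have [] := bP i.
by rewrite size_map size_enum_ord.
Qed.

End FiniteSublattices.

(** * Successive differences as measures of strata *)

Section Representation.
Variables (R : realType) (d : Order.disp_t) (K : tDistrLatticeType d).
Variables (phi : K -> R) (mu : {measure set (borelOFilt K) -> \bar R}).
Hypotheses (mu_phi : represents mu phi) (phi1 : phi \top = 1%R).
Implicit Types (x z : K) (F : {fset K}).

Lemma measurable_ofilt_mem x :
  measurable ([set V : OFilt K | ofilt_set V x] : set (borelOFilt K)).
Proof. by apply: sub_sigma_algebra; apply: open_ofilt_mem. Qed.

Lemma represents_setT : mu [set: OFilt K] = 1%E.
Proof.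
rewrite -phi1 mu_phi; congr (mu _).
by apply/seteqP; split=> // V _; apply: ofilt_top.
Qed.

Lemma represents_fin (A : set (borelOFilt K)) : measurable A -> (mu A < +oo)%E.
Proof.
move=> mA; apply: (@le_lt_trans _ _ 1%E); last exact: ltry.
by rewrite -represents_setT; apply: le_measure; rewrite ?inE.
Qed.

Lemma represents_setC (A : set (borelOFilt K)) : measurable A ->
  mu (~` A) = (1 - mu A)%E.
Proof.
move=> mA; rewrite -setTD measureD// ?setTI; last exact: represents_fin.
by congr (_ - _)%E; exact: represents_setT.
Qed.

Lemma measurable_avoid (s : seq K) :
  measurable ([set V : OFilt K | forall b, b \in s -> ~ ofilt_set V b]
    : set (borelOFilt K)).
Proof.
rewrite [X in measurable X](_ : _ =
  \big[setI/setT]_(b <- s) ~` [set V : OFilt K | ofilt_set V b]).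
  by apply: bigsetI_measurable => b _; apply: measurableC;
    exact: measurable_ofilt_mem.
by rewrite -bigcap_seq; apply/seteqP; split=> V nV b bs; apply: nV.
Qed.

(** A filter contains [x]&[z] exactly when it contains both, so the difference removes from [G] the
    filters through [z]. *)
Lemma nabla1_measure (f : K -> R) (G : set (borelOFilt K)) z :
  measurable G ->
  (forall x, (f x)%:E = mu (G `&` [set V | ofilt_set V x])) ->
  forall x, (nabla1 f z x)%:E =
    mu ((G `&` ~` [set V | ofilt_set V z]) `&` [set V | ofilt_set V x]).
Proof.
move=> mG fG x; rewrite /nabla1 EFinB !fG.
have mGx : measurable (G `&` [set V | ofilt_set V x]).
  by apply: measurableI => //; apply: measurable_ofilt_mem.
rewrite (_ : [set V | ofilt_set V (x `&` z)%O] =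
    [set V | ofilt_set V x] `&` [set V | ofilt_set V z]); last first.
  apply/seteqP; split=> V /=; last by move=> [Vx Vz]; apply: ofiltI.
  move=> Vxz; split; first exact: ofilt_upper Vxz (leIl _ _).
  exact: ofilt_upper Vxz (leIr _ _).
rewrite setIA -measureD//; first by rewrite setDE setIAC.
  exact: measurable_ofilt_mem.
exact: represents_fin.
Qed.

(** Stated for arbitrary [f] and [G] because [foldl] changes the function at each step of the
    induction. *)
Lemma nablas_measure (s : seq K) (f : K -> R) (G : set (borelOFilt K)) :
  measurable G ->
  (forall x, (f x)%:E = mu (G `&` [set V | ofilt_set V x])) ->
  forall x, (foldl (@nabla1 R d K) f s x)%:E =
    mu ((G `&` [set V | forall b, b \in s -> ~ ofilt_set V b]) `&`
        [set V | ofilt_set V x]).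
Proof.
elim: s f G => [|z s IHs] f G mG fG x /=.
  by rewrite fG; congr (mu (_ `&` _)); apply/seteqP; split=> V //= [].
have mz := measurableC (measurable_ofilt_mem z).
rewrite (IHs _ _ (measurableI _ _ mG mz) (nabla1_measure z mG fG)).
congr (mu (_ `&` _)); rewrite -setIA; congr setI.
apply/seteqP; split=> V /=.
  by move=> [Vz Vs] b; rewrite inE => /predU1P[->|/Vs].
move=> nV; split=> [|b bs]; first by apply: nV; rewrite inE eqxx.
by apply: nV; rewrite inE bs orbT.
Qed.

Lemma measurable_stratum F x :
  measurable (stratum F x : set (borelOFilt K)).
Proof.
apply: measurableI; first exact: measurable_ofilt_mem.
exact: (measurable_avoid (enum_fset (max_not_above F x))).
Qed.

Lemma nabla_stratum F x :
  (nabla (max_not_above F x) phi x)%:E = mu (stratum F x).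
Proof.
rewrite (nablas_measure _ measurableT) => [|z]; last by rewrite setTI mu_phi.
by congr (mu _); rewrite setTI setIC.
Qed.

(** The [if] keeps the union indexed by all of [F], so that finite additivity matches the
    conditional sum term by term. *)
Definition low_strata F k : set (OFilt K) :=
  \bigcup_(x in [set` F])
    if (#|` max_not_above F x| <= k)%N then stratum F x else set0.

Lemma low_strataP F k V : low_strata F k V <->
  exists x, [/\ x \in F, (#|` max_not_above F x| <= k)%N & stratum F x V].
Proof.
split=> [[x /= xF]|[x [xF le_k xV]]]; last by exists x => //; rewrite le_k.
by case: ifP => // le_k xV; exists x.
Qed.

Lemma measurable_low_strata F k :
  measurable (low_strata F k : set (borelOFilt K)).
Proof.
apply: fin_bigcup_measurable => // x _; case: ifP => _ //.
exact: measurable_stratum.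
Qed.

Lemma sum_nabla_low_strata F k :
  (\sum_(x <- enum_fset F | (#|` max_not_above F x| <= k)%N)
     nabla (max_not_above F x) phi x)%:E = mu (low_strata F k).
Proof.
rewrite /low_strata bigcup_fset measure_fbigsetU; last 2 first.
- by move=> x _; case: ifP => _ //; apply: measurable_stratum.
- move=> x y xF yF [V []].
  case: ifP => // _ xV; case: ifP => // _ yV.
  exact: stratum_inj xF yF xV yV.
rewrite -sumEFin big_mkcond; apply: eq_bigr => x _.
by case: ifP => _; rewrite ?measure0// nabla_stratum.
Qed.

Hypothesis domK : is_domain K.
Hypothesis top_compact : way_below (\top : K) (\top : K).
Hypothesis mulK : way_below_multiplicative K.

Lemma measurable_scattered w n :
  measurable (scattered w n : set (borelOFilt K)).
Proof. by apply: sub_sigma_algebra; apply: open_scattered. Qed.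

Lemma not_scattered_sub_low_strata w F k : finite_sublattice F ->
  (forall z, z \in F -> way_below w z) ->
  ~` scattered w k.+1 `<=` low_strata F k.
Proof.
move=> sF wF V nV; have [x xF xV] := stratum_cover V sF.
apply/low_strataP; exists x; split=> //; rewrite leqNgt; apply/negP => ltk.
exact/nV/(stratum_scattered sF wF xV ltk).
Qed.

(** A compact part [C] of the scattered set is covered by finitely many [scattered_nbhd a]. One
    finite sublattice contains all the points of these [a], so [C] misses its low strata and has
    measure at most [delta]; inner regularity concludes. *)
Lemma scattered_measure_le (delta : R) w k : radon_measure mu ->
  (forall F, finite_sublattice F -> w <= fbottom F ->
     ((1 - delta)%:E <= mu (low_strata F k))%E) ->
  (mu (scattered w k.+1) <= delta%:E)%E.
Proof.
move=> [_ radonU _] le_low; rewrite radonU; last exact: open_scattered.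
apply: ge_ereal_sup => _ [C [cC CS] <-].
have [D wD CD] : finite_subset_cover
    [set a : 'I_k.+1 -> K | forall i, w <= a i] (@scattered_nbhd d K k.+1) C.
  move: cC; rewrite compact_cover; apply.
    by move=> a _; apply: open_scattered_nbhd.
  by rewrite /cover -scattered_bigcup.
have [|F [sF wF DF]] := @finite_sublattice_generated d K w
    (flatten [seq [seq a i | i <- enum 'I_k.+1] | a <- enum_fset D]).
  move=> _ /flattenP[_ /mapP[a aD ->] /mapP[i _ ->]].
  by have := wD a aD; rewrite inE; apply.
have Chigh : C `<=` ~` low_strata F k.
  move=> V /CD[a aD Va] /low_strataP[x [xF le_k xV]].
  suff : (k.+1 <= #|` max_not_above F x|)%N by rewrite ltnNge le_k.
  apply: scattered_nbhd_stratum Va xV => i; apply: DF.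
  apply/flattenP; exists [seq a i | i <- enum 'I_k.+1]; first exact: map_f.
  by apply: map_f; rewrite mem_enum.
have mlow := measurable_low_strata F k.
apply: (@le_trans _ _ (mu (~` low_strata F k))).
  apply: le_measure => //; rewrite inE; last exact: measurableC.
  exact: compact_measurable.
rewrite represents_setC//.
have fin_low : mu (low_strata F k) \is a fin_num.
  by rewrite ge0_fin_numE// represents_fin.
by rewrite leeBlDr// -leeBlDl// -EFinB; apply: le_low => //; apply: fbottom_ge.
Qed.

End Representation.

(** * Both implications, by countable subadditivity and continuity from below *)

Theorem theorem8p5 (R : realType) (d : Order.disp_t) (K : tDistrLatticeType d)
  (domK : is_domain K)
  (top_compact : way_below (\top : K)%O (\top : K)%O)
  (mulK : way_below_multiplicative K)
  (sigmaK : sigma_compact K)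
  (w : nat -> K)
  (w_cover : (\bigcup_i principal_upper (w i) = setT)%classic)
  (w_decr : forall i, way_below (w i.+1) (w i))
  (phi : K -> R)
  (scott_phi : scott_function phi)
  (cm_phi : completely_monotone phi)
  (mu : {measure set (borelOFilt K) -> \bar R})
  (radon_mu : radon_measure mu)
  (mu_phi : represents mu phi) :
  locally_finite_valuation phi <-> mu (lf_primeOFilt w) = 1%E.
Proof.
have phi1 : phi \top = 1%R by case: scott_phi.
have mS x n := measurable_scattered domK top_compact mulK x n.
have mE x : measurable (\bigcup_(k in [set k | (0 < k)%N])
    ~` scattered x k.+1 : set (borelOFilt K)).
  by apply: bigcup_measurable => k _; apply: measurableC.
have mP : measurable (lf_primeOFilt w : set (borelOFilt K)).
  by rewrite lf_primeOFiltE//; apply: bigcap_measurableType => i _.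
split=> [lfphi|mu1 v delta delta0].
- suff null : mu (~` lf_primeOFilt w) = 0%E.
    rewrite -[lf_primeOFilt w]setCK (represents_setC mu_phi phi1).
      by rewrite null sube0.
    exact: measurableC.
  apply/negligibleP; first exact: measurableC.
  (* It suffices to treat one [w i]; there the exceptional set lies in [scattered (w i) k.+1] for
     every positive [k], and each [delta] bounds one of these. *)
  rewrite lf_primeOFiltE// setC_bigcap; apply: negligible_bigcup => i.
  apply/negligibleP; first exact: measurableC.
  apply/eqP; rewrite eq_le measure_ge0 andbT.
  apply/lee_addgt0Pr => delta delta0.
  rewrite add0e; have [k k0 le_low] := lfphi (w i) delta delta0.
  apply: (@le_trans _ _ (mu (scattered (w i) k.+1))).
    apply: le_measure; rewrite ?inE//; first exact: measurableC.
    by rewrite setC_bigcup => V /(_ k k0); rewrite setCK.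
  apply: scattered_measure_le => // F sF wF.
  by rewrite -(sum_nabla_low_strata mu_phi phi1) lee_fin le_low.
- have [i _ wv] : (\bigcup_i principal_upper (w i)) v by rewrite w_cover.
  (* The index [i.+1] makes [w i.+1] way below everything above [v], as
     [not_scattered_sub_low_strata] requires. *)
  pose E k : set (borelOFilt K) := ~` scattered (w i.+1) k.+1.
  have [k k0 Ek] : exists2 k, (0 < k)%N & ((1 - delta)%:E <= mu (E k))%E.
    (* Otherwise the increasing sets [E k], whose union contains [lf_primeOFilt w], would have limit
       measure at most [1 - delta]. *)
    apply: contrapT => nE.
    have mE' : measurable (\bigcup_k E k).
      by apply: bigcup_measurable => k _; apply: measurableC.
    have cvgE : (mu \o E) n @[n --> \oo] --> mu (\bigcup_k E k).
      apply: nondecreasing_cvg_mu => // [k|]; first exact: measurableC.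
      apply/nondecreasing_seqP => k; apply/subsetPset/subsetC.
      exact: scatteredS.
    have : (1 <= (1 - delta)%:E :> \bar R)%E.
      rewrite -mu1; apply: (@le_trans _ _ (mu (\bigcup_k E k))).
        apply: le_measure; rewrite ?inE// lf_primeOFiltE//.
        by move=> V /(_ i.+1 I)[k _ Vk]; exists k.
      rewrite -(cvg_lim _ cvgE)//; apply: lime_le; first exact: cvgP cvgE.
      (* The bound is only available for positive [k], hence the tail from 1. *)
      exists 1%N => // k /= k0; rewrite leNgt; apply/negP => /ltW Ek.
      by apply: nE; exists k.
    by rewrite lee_fin lerBrDl -lerBrDr subrr leNgt delta0.
  exists k => // F sF vF; rewrite -lee_fin (sum_nabla_low_strata mu_phi phi1).
  apply: le_trans Ek _; apply: le_measure; rewrite ?inE.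
  + exact: measurableC.
  + exact: measurable_low_strata.
  apply: not_scattered_sub_low_strata => // z zF.
  apply: way_below_trans (w_decr i) _; apply: le_trans wv _.
  exact: le_fbottom zF.
Qed.
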